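(* Let $\mu$ be a log-concave probability measure on $\mathbb{R}^n$. Then for every $\varepsilon\in(0,1)$ and every $x\in\mathbb{R}^n$, \[ \Lambda_\mu^\ast(x)\geqslant (1-\varepsilon)\log\frac{1}{q_\mu(x)}+\log\frac{\varepsilon}{2^{1-\varepsilon}} \] (with the convention $\log(1/0)=+\infty$).
   Context: For a probability measure $\mu$ on $\mathbb{R}^n$ and a random vector $X\sim\mu$: the half-space (Tukey) depth is $q_\mu(x)=\inf\{\mu(H): H \text{ a closed half-space containing } x\}=\inf_{\xi\in S^{n-1}}\mathbb{P}(\langle X,\xi\rangle\geqslant\langle x,\xi\rangle)$; the cumulant generating function is $\Lambda_\mu(\xi)=\log\mathbb{E}e^{\langle X,\xi\rangle}$ (possibly $+\infty$); the Cramér transform is its Legendre transform $\Lambda_\mu^\ast(x)=\sup_{\xi\in\mathbb{R}^n}\big(\langle x,\xi\rangle-\Lambda_\mu(\xi)\big)\in[0,+\infty]$. A Borel measure $\mu$ is log-concave if $\mu((1-\lambda)A+\lambda B)\geqslant\mu(A)^{1-\lambda}\mu(B)^\lambda$ for all Borel $A,B$ and $\lambda\in(0,1)$. *)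

(* Defs.v *)
From HB Require Import structures.
From mathcomp Require Import all_boot all_order all_algebra.
From mathcomp Require Import all_classical all_reals all_analysis.
Set Implicit Arguments. Unset Strict Implicit. Unset Printing Implicit Defensive.
Import Order.TTheory GRing.Theory Num.Theory numFieldNormedType.Exports.
Local Open Scope classical_set_scope.
Local Open Scope ring_scope.

Definition Rn (R : realType) (n : nat) :=
  g_sigma_algebraType (@open ('rV[R]_n : topologicalType)).

Definition dotr (R : realType) (n : nat) (u v : 'rV[R]_n) : R :=
  \sum_(i < n) u ord0 i * v ord0 i.

Definition unit_sphere (R : realType) (n : nat) : set 'rV[R]_n :=
  [set xi | dotr xi xi = 1].

Definition mink_comb (R : realType) (n : nat) (l : R) (A B : set 'rV[R]_n)
  : set 'rV[R]_n :=
  [set (1 - l) *: a + l *: b | a in A & b in B].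

(* log-concavity: mu((1-l)A + lB) >= mu(A)^(1-l) mu(B)^l for Borel A, B
   (whenever the Minkowski combination is Borel, so that mu of it is meaningful) *)
Definition log_concave (R : realType) (n : nat)
  (mu : probability (Rn R n) R) : Prop :=
  forall (A B : set (Rn R n)) (l : R),
    measurable A -> measurable B -> 0 < l < 1 ->
    measurable (mink_comb l A B : set (Rn R n)) ->
    (fine (mu A)) `^ (1 - l) * (fine (mu B)) `^ l
      <= fine (mu (mink_comb l A B : set (Rn R n))).

Local Open Scope ereal_scope.

Definition tukey_depth (R : realType) (n : nat)
  (mu : probability (Rn R n) R) (x : 'rV[R]_n) : \bar R :=
  ereal_inf [set mu ([set y : Rn R n | (dotr x xi <= dotr y xi)%R])
            | xi in @unit_sphere R n].

Definition cgf (R : realType) (n : nat)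
  (mu : probability (Rn R n) R) (xi : 'rV[R]_n) : \bar R :=
  lne (\int[mu]_(y in [set: Rn R n]) (expR (dotr y xi))%:E).

Definition cramer (R : realType) (n : nat)
  (mu : probability (Rn R n) R) (x : 'rV[R]_n) : \bar R :=
  ereal_sup [set (dotr x xi)%:E - cgf mu xi | xi in [set: 'rV[R]_n]].

(* Main.v *)
Require Import Defs.
From HB Require Import structures.
From mathcomp Require Import all_boot all_order all_algebra.
From mathcomp Require Import all_classical all_reals all_analysis.
From mathcomp Require Import measurable_realfun ring lra.
Import Order.TTheory GRing.Theory Num.Theory numFieldNormedType.Exports.
Local Open Scope classical_set_scope.
Local Open Scope ring_scope.

(** Both sides reduce to the one-dimensional marginals [Y = <X, xi>], whose
    tails [g u = P(Y >= u)] are log-concave because a Minkowski combination of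
    parallel half-spaces is a half-space.  If [g s < Q < 1], a chord of
    [ln g] ending at [s] gives [p > 0] with [g u <= Q e^(p (s - u))] for
    all [u].  For [t = (1 - eps) p] the tails of [e^(t Y)] then decay like
    [r^(-1 / (1 - eps))], and integrating the bound [min(1, tail)] yields
    [E e^(t Y) <= e^(t s) Q^(1 - eps) / eps].  Hence
    [Lambda^* (x) >= (1 - eps) ln (1 / Q) + ln eps] for every [Q < 1] above
    the depth; the factor [2^(1 - eps)] is the room for [Q = 2 q(x)]. *)

(** * Exponential tail bounds for log-concave functions *)

(** When [g s > 0], the rate [p] is minus the slope of the chord of [ln g] over [[m, s]]; the point
    [z], where [g] is at least [Q], prevents this chord from being flat. *)
Lemma log_concave_exp_tail (R : realType) (g : R -> R) (s m z Q : R) :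
  (forall u, 0 <= g u <= 1) ->
  {homo g : u v / u <= v >-> v <= u} ->
  (forall a b l : R, 0 < l < 1 ->
     g a `^ (1 - l) * g b `^ l <= g ((1 - l) * a + l * b)) ->
  0 < Q -> g s < Q -> m < s -> g m <= Q -> Q <= g z ->
  exists2 p, 0 < p & forall u, g u <= Q * expR (p * (s - u)).
Proof.
move=> g01 gdec glc Q0 gsQ ms gmQ Qgz.
have ge0 u : 0 <= g u by have /andP[] := g01 u.
have le1 u : g u <= 1 by have /andP[] := g01 u.
(* Concavity of [ln g] with denominators cleared. Positivity at [b] is part of the claim, since [ln]
   is 0 at nonpositive arguments. *)
have chord a b c : a < b -> b < c -> 0 < g a -> 0 < g c ->
    0 < g b /\ (c - b) * ln (g a) + (b - a) * ln (g c) <= (c - a) * ln (g b).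
  move=> ab bc ga gc.
  have ca : 0 < c - a by lra.
  have [l l01 lca] : exists2 l, 0 < l < 1 & l * (c - a) = b - a.
    exists ((b - a) / (c - a)); last by rewrite divfK// gt_eqF.
    by rewrite divr_gt0 ?ltr_pdivrMr//; lra.
  have := glc a c l l01.
  have -> : (1 - l) * a + l * c = b by move: lca; lra.
  move=> gb.
  have gb0 : 0 < g b by apply: lt_le_trans gb; rewrite mulr_gt0// powR_gt0.
  split => //.
  move: gb; rewrite -ler_ln ?posrE// ?mulr_gt0 ?powR_gt0//.
  rewrite lnM ?posrE ?powR_gt0// !ln_powR => gb.
  have -> : c - b = (c - a) * (1 - l) by rewrite mulrBr mulr1 (mulrC _ l) lca; ring.
  by rewrite -lca (mulrC l) -!mulrA -mulrDr ler_wpM2l// ltW.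
have [gs0|gs0] := leP (g s) 0.
  (* [ln (g s)] is junk here; any slope steep enough to pass 1 before [m] works. *)
  exists ((1 + `|ln Q|) / (s - m)).
    by rewrite divr_gt0//; have := normr_ge0 (ln Q); lra.
  move=> u; have [su|us] := leP s u.
    rewrite (le_trans (gdec _ _ su))// (le_trans gs0)//.
    by rewrite mulr_ge0 ?expR_ge0// ltW.
  set p := _ / _.
  have p0 : 0 <= p by rewrite divr_ge0//; have := normr_ge0 (ln Q); lra.
  have [mu|um] := leP m u.
    rewrite (le_trans (gdec _ _ mu))// (le_trans gmQ)// ler_peMr ?(ltW Q0)//.
    by rewrite -(@expR0 R) ler_expR mulr_ge0//; lra.
  rewrite (le_trans (le1 _))// -[Q]lnK ?posrE// -expRD -(@expR0 R) ler_expR.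
  have : p * (s - m) <= p * (s - u) by rewrite ler_wpM2l//; lra.
  rewrite {1}/p divfK; last by rewrite subr_eq0 gt_eqF.
  by have := ler_norm (- ln Q); rewrite normrN; lra.
have gpos u : u <= s -> 0 < g u by move=> us; exact: lt_le_trans (gdec _ _ us).
(* If [g m = g s < Q], then [z] lies left of [m], and a concave [ln g] that drops from [z] to [m]
   cannot be flat from [m] to [s]. *)
have gsm : g s < g m.
  rewrite lt_neqAle gdec ?ltW// andbT; apply/eqP => gsm.
  have zm : z < m.
    by rewrite ltNge; apply/negP => /gdec; rewrite -gsm leNgt (lt_le_trans gsQ).
  have [_] := chord z m s zm ms (gpos _ (ltW (lt_trans zm ms))) gs0.
  rewrite -gsm leNgt => /negP; apply.
  have gz0 : 0 < g z by exact: lt_le_trans Qgz.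
  have : (s - m) * (ln (g z) - ln (g s)) > 0.
    by rewrite mulr_gt0 ?subr_gt0// ltr_ln ?posrE// (lt_le_trans gsQ).
  lra.
pose p := (ln (g m) - ln (g s)) / (s - m).
have sm0 : 0 < s - m by lra.
have gm0 : 0 < g m by exact: lt_trans gsm.
have p0 : 0 < p by rewrite divr_gt0// subr_gt0 ltr_ln ?posrE.
have pE : p * (s - m) = ln (g m) - ln (g s) by rewrite divfK// gt_eqF.
exists p => // u.
(* Outside [[m, s]] concavity puts [ln g] below the line through its values at [m] and [s]. Inside
   it lies above that line, and [g u <= g m <= Q] is used instead. *)
have [mu|um] := leP m u; last first.
  have us : u < s by exact: lt_trans ms.
  have [_ H] := chord u m s um ms (gpos _ (ltW us)) gs0.
  apply: (@le_trans _ _ (g s * expR (p * (s - u)))).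
    have gu0 : 0 < g u by exact/gpos/ltW.
    rewrite -{1}[g s]lnK ?posrE// -expRD -[leLHS]lnK ?posrE// ler_expR.
    rewrite -(ler_pM2l sm0).
    have -> : (s - m) * (ln (g s) + p * (s - u)) =
       (s - m) * ln (g s) + (ln (g m) - ln (g s)) * (s - u).
      by rewrite -pE; ring.
    lra.
  by rewrite ler_wpM2r ?expR_ge0// ltW.
have [us|su] := leP u s.
  rewrite (le_trans (gdec _ _ mu))// (le_trans gmQ)// ler_peMr ?(ltW Q0)//.
  by rewrite -(@expR0 R) ler_expR mulr_ge0//; lra.
have [gu0|gu0] := leP (g u) 0.
  by rewrite (le_trans gu0)// mulr_ge0 ?expR_ge0// ltW.
have [_ H] := chord m s u ms su gm0 gu0.
apply: (@le_trans _ _ (g s * expR (p * (s - u)))).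
  rewrite -{1}[g s]lnK ?posrE// -expRD -[leLHS]lnK ?posrE// ler_expR.
  rewrite -(ler_pM2l sm0).
  have -> : (s - m) * (ln (g s) + p * (s - u)) =
     (s - m) * ln (g s) + (ln (g m) - ln (g s)) * (s - u).
    by rewrite -pE; ring.
  lra.
by rewrite ler_wpM2r ?expR_ge0// ltW.
Qed.

(** * Moments from tail bounds *)

Lemma powRN_cvgy0 (R : realType) (c : R) : 0 < c ->
  r `^ (- c) @[r --> +oo] --> 0.
Proof.
move=> c0; apply/cvgr0Pnorm_lt => e e0; near=> r.
have r0 : 0 < r by near: r; exact: nbhs_pinfty_gt.
rewrite ger0_norm ?powR_ge0// /powR gt_eqF// -[ltRHS]lnK ?posrE// ltr_expR.
have : expR (- ln e / c) < r by near: r; exact: nbhs_pinfty_gt.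
rewrite -ltr_ln ?posrE ?expR_gt0// expRK ltr_pdivrMr//; lra.
Unshelve. all: by end_near. Qed.

(** The antiderivative [- (Q / c) * r ^ (- c)] vanishes at infinity because [c > 0]. *)
Lemma integral_powRN (R : realType) (Q c r0 : R) : 0 <= Q -> 0 < c -> 0 < r0 ->
  (\int[lebesgue_measure]_(r in `[r0, +oo[) (Q * r `^ (- (1 + c)))%:E =
   (Q / c * r0 `^ (- c))%:E)%E.
Proof.
move=> Q0 c0 r00.
pose F (r : R) : R := - (Q / c) * r `^ (- c).
have dF (r : R) : 0 < r -> is_derive r 1 F (Q * r `^ (- (1 + c))).
  move=> r_gt0.
  have -> : Q * r `^ (- (1 + c)) = - (Q / c) *: (- c * r `^ (- c - 1)).
    rewrite /GRing.scale/= mulrA mulrNN divfK ?gt_eqF//.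
    by rewrite opprD addrC.
  by apply: is_deriveZ; exact: is_derive1_powR.
have cF (r : R) : 0 < r -> {for r, continuous F}.
  move=> r_gt0; apply: differentiable_continuous; apply/derivable1_diffP.
  by have [] := dF _ r_gt0.
rewrite (@ge0_continuous_FTC2y _ _ F r0 0).
- by rewrite -EFinB /F mulNr sub0r opprK.
- by move=> r _; rewrite mulr_ge0// powR_ge0.
- apply: continuous_in_subspaceT => r; rewrite inE/= in_itv/= andbT => rr.
  have r_gt0 : 0 < r by exact: lt_le_trans rr.
  apply: cvgM; first exact: cvg_cst.
  suff : {for r, continuous (fun u : R => u `^ (- (1 + c)))} by [].
  apply: differentiable_continuous; apply/derivable1_diffP.
  by apply: derivable_powR; rewrite in_itv/= r_gt0.
- rewrite -(mulr0 (- (Q / c))); apply: cvgM; first exact: cvg_cst.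
  exact: powRN_cvgy0.
- by move=> r rr; have [] := dF _ (lt_trans r00 rr).
- exact/cvg_at_right_filter/cF.
- move=> r; rewrite in_itv/= andbT => rr.
  by rewrite derive1E; apply: derive_val; apply: dF; exact: lt_trans rr.
Qed.

Lemma expectation_le_powR_tail (d : measure_display) (T : measurableType d)
    (R : realType) (P : probability T R) (X : {RV P >-> R}) (Q eps : R) :
  (forall x, 0 <= X x) -> 0 < Q -> 0 < eps < 1 ->
  (forall r, (0 < r)%R -> ccdf X r <= (Q * r `^ (- (1 - eps)^-1))%:E)%E ->
  ('E_P[X] <= (Q `^ (1 - eps) / eps)%:E)%E.
Proof.
move=> X0 Q0 /andP[eps0 eps1] tail.
rewrite ge0_expectation_ccdf//.
(* At [r0] the power bound equals 1: the trivial bound is used below it, the power bound above. The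
   exponent is written [1 + c] so that the tail integral has exponent [- c]. *)
pose r0 := Q `^ (1 - eps).
pose c := eps / (1 - eps).
have r00 : 0 < r0 by rewrite powR_gt0.
have eps10 : 1 - eps != 0 by rewrite subr_eq0 gt_eqF.
have c0 : 0 < c by rewrite divr_gt0// subr_gt0.
have cE : (1 - eps)^-1 = 1 + c by rewrite /c; field.
have mccdf (A : set R) : measurable_fun A (ccdf X).
  by apply: measurable_funTS; exact: ccdf_measurable.
have -> : `[0, +oo[%classic = (`[0, r0[ `|` `[r0, +oo[)%classic :> set R.
  by rewrite -itv_bndbnd_setU// bnd_simp ltW.
rewrite ge0_integral_setU//=; first last.
- apply/disj_setPS => r [] /=; rewrite !in_itv/= => /andP[_ rr].
  by rewrite leNgt rr.
- exact: mccdf.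
(* The two pieces are [r0] and [r0 / c], and [1 + 1 / c = 1 / eps]. *)
have -> : Q `^ (1 - eps) / eps = r0 + Q / c * r0 `^ (- c).
  have -> : Q / c * r0 `^ (- c) = r0 / c.
    rewrite mulrAC; congr (_ / c).
    rewrite /r0 -powRrM -{1}(powRr1 (ltW Q0)) -powRD; last first.
      by rewrite (gt_eqF Q0) implybT.
    by congr (_ `^ _); rewrite /c; field.
  by rewrite -/r0 /c invf_div mulrA mulrBr mulr1 mulrBl mulfK ?gt_eqF// addrC subrK.
rewrite EFinD; apply: leeD.
- apply: (@le_trans _ _ (\int[lebesgue_measure]_(r in `[0%R, r0[) cst 1 r)%E).
    apply: ge0_le_integral => //=; first exact: mccdf.
    by move=> r _; exact: probability_le1.
  by rewrite integral_cst//= mul1e lebesgue_measure_itv/= lte_fin r00 sube0.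
- rewrite -integral_powRN ?(ltW Q0)//; apply: ge0_le_integral => //=.
  + exact: mccdf.
  + apply/measurable_EFinP; apply: measurable_funM => //.
    by apply: measurable_funTS; exact: measurable_powR.
  + move=> r; rewrite in_itv/= andbT => rr.
    by rewrite -cE tail// (lt_le_trans r00).
Qed.

Lemma exp_moment_log_concave_tail (d : measure_display) (T : measurableType d)
    (R : realType) (P : probability T R) (Y : {RV P >-> R}) (s Q eps : R) :
  let g u := fine (P [set y | u <= Y y]) in
  (forall a b l : R, 0 < l < 1 ->
     g a `^ (1 - l) * g b `^ l <= g ((1 - l) * a + l * b)) ->
  0 < Q < 1 -> g s < Q -> 0 < eps < 1 ->
  exists t : R, (\int[P]_y (expR (t * Y y))%:E <=
                 (expR (t * s) * (Q `^ (1 - eps) / eps))%:E)%E.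
Proof.
move=> g glc /andP[Q0 Q1] gsQ /andP[eps0 eps1].
have mtail u : measurable [set y | u <= Y y].
  rewrite -[X in measurable X]setTI.
  have := @measurable_funPT _ _ _ _ Y measurableT `[u, +oo[%classic
    (measurable_itv _).
  congr measurable; congr (_ `&` _); apply/seteqP.
  by split => y /=; rewrite in_itv/= andbT.
have gE u : P [set y | u <= Y y] = (g u)%:E.
  by rewrite fineK ?fin_num_measure.
have g01 u : 0 <= g u <= 1.
  by rewrite -!lee_fin -gE measure_ge0 probability_le1.
have gdec : {homo g : u v / u <= v >-> v <= u}.
  move=> u v uv; rewrite -lee_fin -!gE; apply: le_measure; rewrite ?inE//.
  by move=> y /=; exact: le_trans.
(* The cdf of [- Y] at [r] is [g (- r)]: its right continuity at [- s] supplies [m], and its limit 1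
   at infinity, with [Q < 1], supplies [z]. *)
pose W : {RV P >-> R} := (\- Y : {mfun T >-> R}).
have cdfE r : cdf W r = (g (- r))%:E.
  rewrite -gE /cdf /distribution /pushforward; congr (P _).
  by apply/seteqP; split => y /=; rewrite in_itv/= lerNl.
have [m ms gmQ] : exists2 m, m < s & g m <= Q.
  have /(_ (- s)) := @cdf_right_continuous _ _ _ _ W.
  rewrite cdfE opprK => /fine_cvg/cvgr_lt/(_ _ gsQ) near_lt.
  have [r []] : exists r, fine (cdf W r) < Q /\ - s < r.
    apply: (@filter_ex _ (nbhs (- s)^'+)).
    by apply: filterI => //; exact: nbhs_right_gt.
  rewrite cdfE/= => rQ sr; exists (- r); last exact: ltW.
  by rewrite ltrNl.
have [z Qgz] : exists z, Q <= g z.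
  have /fine_cvg/cvgr_gt/(_ _ Q1)/filter_ex[r] := @cvg_cdfy1 _ _ _ _ W.
  by rewrite /= cdfE => Qr; exists (- r); exact: ltW.
have [p p0 gp] :=
  @log_concave_exp_tail _ g s m z Q g01 gdec glc Q0 gsQ ms gmQ Qgz.
pose t := (1 - eps) * p.
have eps10 : 0 < 1 - eps by rewrite subr_gt0.
have t0 : 0 < t by rewrite mulr_gt0.
exists t.
have mZ : measurable_fun setT (fun y => expR (t * Y y)).
  apply: measurableT_comp => //; exact: measurable_funM.
pose Z : {RV P >-> R} := mfun_Sub (mem_set mZ).
have -> : (\int[P]_y (expR (t * Y y))%:E = 'E_P[Z])%E by rewrite unlock.
(* At [u = ln r / t] the bound on [g u] reads [Q e^(p s) r^(-1 / (1 - eps))], so the moment lemma is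
   applied with [Q e^(p s)] as its constant. *)
have -> : expR (t * s) * (Q `^ (1 - eps) / eps) =
    (Q * expR (p * s)) `^ (1 - eps) / eps.
  rewrite powRM ?(ltW Q0) ?expR_ge0// mulrA; congr (_ / _).
  by rewrite mulrC -expRM /t -mulrA (mulrC _ (p * s)).
apply: expectation_le_powR_tail.
- by move=> y; exact: expR_ge0.
- by rewrite mulr_gt0 ?expR_gt0.
- by rewrite eps0.
move=> r r0.
(* [ccdf] uses a strict inequality and [g] a large one; an inclusion of events suffices. *)
apply: (@le_trans _ _ (P [set y | ln r / t <= Y y])).
  rewrite /ccdf /distribution /pushforward; apply: le_measure; rewrite ?inE//.
    have := @measurable_funPT _ _ _ _ Z measurableT `]r, +oo[%classic
      (measurable_itv _).
    by rewrite setTI.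
  move=> y /=; rewrite in_itv/= andbT => rZ.
  rewrite ler_pdivrMr// mulrC -ler_expR lnK ?posrE//; exact: ltW.
rewrite gE lee_fin (le_trans (gp _))//.
rewrite -mulrA ler_pM2l// /powR gt_eqF// -expRD ler_expR.
rewrite mulrBr lerD2l /t.
have -> : p * (ln r / ((1 - eps) * p)) = (1 - eps)^-1 * ln r.
  by field; rewrite !gt_eqF.
by rewrite mulNr.
Qed.

(** * Linear functionals and half-spaces *)

Lemma dotrDl (R : realType) (n : nat) (u v w : 'rV[R]_n) :
  dotr (u + v) w = dotr u w + dotr v w.
Proof. by rewrite -big_split; apply: eq_bigr => i _; rewrite mxE mulrDl. Qed.

Lemma dotrZl (R : realType) (n : nat) (c : R) (u v : 'rV[R]_n) :
  dotr (c *: u) v = c * dotr u v.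
Proof.
by rewrite /dotr mulr_sumr; apply: eq_bigr => i _; rewrite mxE mulrA.
Qed.

Lemma dotrZr (R : realType) (n : nat) (c : R) (u v : 'rV[R]_n) :
  dotr u (c *: v) = c * dotr u v.
Proof.
by rewrite /dotr mulr_sumr; apply: eq_bigr => i _; rewrite mxE mulrCA.
Qed.

Lemma dotr_continuous (R : realType) (n : nat) (xi : 'rV[R]_n) :
  continuous (fun y : 'rV[R]_n => dotr y xi).
Proof.
apply: continuous_big => [|i _ y]; first exact: add_continuous.
apply: (@cvgM R _ (nbhs y)); last exact: cvg_cst.
exact: (@coord_continuous R 1 n ord0 i).
Qed.

Lemma dotr_measurable (R : realType) (n : nat) (xi : 'rV[R]_n) :
  measurable_fun [set: Rn R n] (fun y : Rn R n => dotr y xi).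
Proof.
apply: (measurability _ (RGenOInfty.measurableE R)) => //.
move=> _ [_ [a ->] <-]; rewrite setTI.
apply: sub_sigma_algebra.
have := @open_comp _ _ (fun y : 'rV[R]_n => dotr y xi) `]a, +oo[%classic.
by apply => [y _|]; [exact: dotr_continuous|exact: interval_open].
Qed.

(** Transfers log-concavity from [mu] to the tails of its marginals; the combination being a
    half-space also settles the measurability condition in [log_concave]. *)
Lemma mink_comb_halfspace (R : realType) (n : nat) (xi : 'rV[R]_n) (a b l : R) :
  0 < l < 1 -> dotr xi xi = 1 ->
  mink_comb l [set y | a <= dotr y xi] [set y | b <= dotr y xi] =
  [set y | (1 - l) * a + l * b <= dotr y xi].
Proof.
move=> /andP[l0 l1] xi1; apply/seteqP; split => [_ [u au [v bv <-]]|y /= aby].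
  by rewrite /= dotrDl !dotrZl lerD// ler_pM2l// subr_gt0.
set e := dotr y xi in aby.
(* The slack [h] is shared by both points: moving [y] along [xi] to the levels [a + h] and [b + h]
   leaves the weighted average equal to [y]. *)
pose h := e - ((1 - l) * a + l * b).
have h0 : 0 <= h by rewrite subr_ge0.
exists (y + (a + h - e) *: xi).
  by rewrite /= dotrDl dotrZl xi1 mulr1 -/e addrCA subrr addr0 lerDl.
exists (y + (b + h - e) *: xi).
  by rewrite /= dotrDl dotrZl xi1 mulr1 -/e addrCA subrr addr0 lerDl.
rewrite !scalerDr !scalerA addrACA -scalerDl -scalerDl subrK scale1r.
rewrite (_ : (1 - l) * _ + l * _ = 0) ?scale0r ?addr0// /h; ring.
Qed.

(** * Lower bounds on the Cramér transform *)

(** A direction [xi] whose half-space has mass below [Q] exists by the infimum, and [t *: xi] is the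
    test vector in the supremum. [Q] stays free so that it can tend to 0 when the depth vanishes. *)
Lemma cramer_ge (R : realType) (n : nat) (mu : probability (Rn R n) R) :
  log_concave mu ->
  forall (eps : R), 0 < eps < 1 ->
  forall (x : 'rV[R]_n) (Q : R), 0 < Q < 1 -> (tukey_depth mu x < Q%:E)%E ->
    (((1 - eps) * - ln Q + ln eps)%:E <= cramer mu x)%E.
Proof.
move=> lc eps eps01 x Q Q01 /ereal_inf_lt[_ [xi xi1 <-]] qQ.
have Q0 : 0 < Q by case/andP : Q01.
have eps0 : 0 < eps by case/andP : eps01.
pose Y : {RV mu >-> R} := mfun_Sub (mem_set (dotr_measurable R n xi)).
have mH u : measurable [set y : Rn R n | u <= dotr y xi].
  have := @measurable_funPT _ _ _ _ Y measurableT `[u, +oo[%classic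
    (measurable_itv _).
  rewrite setTI; congr measurable.
  by apply/seteqP; split => y /=; rewrite in_itv/= andbT.
have [|//||//|t Ht] := @exp_moment_log_concave_tail _ _ _ mu Y (dotr x xi) Q eps.
- move=> a b l l01 /=.
  have := lc _ _ l (mH a) (mH b) l01.
  by rewrite mink_comb_halfspace//; exact.
- by rewrite -lte_fin fineK ?fin_num_measure.
apply: (@le_trans _ _ ((dotr x (t *: xi))%:E - cgf mu (t *: xi))%E); last first.
  by apply: ereal_sup_ubound; exists (t *: xi).
have c0 : 0 < expR (t * dotr x xi) * (Q `^ (1 - eps) / eps).
  by rewrite !mulr_gt0 ?expR_gt0 ?powR_gt0 ?invr_gt0.
have : (cgf mu (t *: xi) <=
    lne (expR (t * dotr x xi) * (Q `^ (1 - eps) / eps))%:E)%E.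
  rewrite lee_lne ?in_itv/= ?leey ?andbT ?lee_fin ?(ltW c0)//.
  - apply: le_trans Ht; rewrite le_eqVlt; apply/orP; left; apply/eqP.
    by apply: eq_integral => y _; rewrite dotrZr.
  - by apply: integral_ge0 => y _; rewrite lee_fin expR_ge0.
rewrite lne_EFin// => H.
have -> : ((1 - eps) * - ln Q + ln eps)%:E =
    ((dotr x (t *: xi))%:E -
     (ln (expR (t * dotr x xi) * (Q `^ (1 - eps) / eps)))%:E)%E.
  rewrite -EFinB dotrZr; congr EFin.
  rewrite lnM ?posrE ?expR_gt0// ?divr_gt0 ?powR_gt0// expRK.
  rewrite ln_div ?posrE ?powR_gt0// ln_powR; ring.
exact: leeB.
Qed.

(** The test vector 0 gives the value 0, as [mu] has mass 1. *)
Lemma cramer_ge0 (R : realType) (n : nat) (mu : probability (Rn R n) R)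
  (x : 'rV[R]_n) : (0 <= cramer mu x)%E.
Proof.
apply: (@le_trans _ _ ((dotr x 0)%:E - cgf mu 0)%E); last first.
  by apply: ereal_sup_ubound; exists 0.
have dot0 (y : 'rV[R]_n) : dotr y 0 = 0.
  by rewrite /dotr big1// => i _; rewrite mxE mulr0.
rewrite /cgf dot0; under eq_integral do rewrite dot0 expR0.
rewrite integral_cst// mul1e [X in lne X](_ : _ = 1%E) ?lne1 ?sube0//.
exact: probability_setT.
Qed.

(* log(1/q) is rendered as - lne q, so that q = 0 gives +oo *)
Theorem theorem1p1 (R : realType) (n : nat) (mu : probability (Rn R n) R) :
  log_concave mu ->
  forall (eps : R), 0 < eps < 1 ->
  forall (x : 'rV[R]_n),
    ((1 - eps)%:E * (- lne (tukey_depth mu x))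
       + (ln (eps / 2 `^ (1 - eps)))%:E <= cramer mu x)%E.
Proof.
move=> lc eps eps01 x; have /andP[eps0 eps1] := eps01.
have key := cramer_ge R n mu lc eps eps01 x.
have eps10 : 0 < 1 - eps by rewrite subr_gt0.
have q0 : (0 <= tukey_depth mu x)%E.
  by apply: le_ereal_inf_tmp => _ [xi _ <-]; exact: measure_ge0.
have lnE : ln (eps / 2 `^ (1 - eps)) = ln eps - (1 - eps) * ln 2.
  by rewrite ln_div ?posrE ?powR_gt0// ln_powR.
rewrite lnE; move: q0 key.
case: (tukey_depth mu x) => [q| |] // q0 key; last first.
  (* Infinite depth arises for [n = 0], where the unit sphere is empty; the left side is then minus
     infinity. *)
  by rewrite /= mulrNy gtr0_sg// mul1e addNye leNye.
rewrite lee_fin le_eqVlt in q0.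
have [q_0|qpos] : q = 0 \/ 0 < q by case/predU1P : q0; [left|right].
  suff -> : cramer mu x = +oo%E by rewrite leey.
  apply: eq_infty => K.
  (* The exponential solves [(1 - eps) * - ln Q + ln eps = K]; the cap [1 / 2] keeps [Q < 1]. *)
  pose Q := Num.min 2^-1 (expR (- ((K - ln eps) / (1 - eps)))).
  have Q0 : 0 < Q by rewrite lt_min invr_gt0 expR_gt0 ltr0n.
  have Q1 : Q < 1 by rewrite gt_min invf_lt1 ?ltr1n.
  have := key Q; rewrite Q0 Q1 q_0 lte_fin Q0 => /(_ isT isT); apply: le_trans.
  rewrite lee_fin -lerBlDr mulrC -ler_pdivrMr// lerNr -ler_expR lnK ?posrE//.
  by rewrite ge_min lexx orbT.
rewrite lne_EFin// -EFinN -EFinM -EFinD.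
have ln2q : ln (2 * q) = ln 2 + ln q by rewrite lnM ?posrE.
(* The left side is [ln eps - (1 - eps) * ln (2 * q)]: negative if [2 * q >= 1], and otherwise
   exactly the bound of [cramer_ge] at [Q = 2 * q > q]. *)
have [q2|q2] := leP 1 (2 * q).
  apply: le_trans (cramer_ge0 _ _ mu x); rewrite lee_fin.
  have : 0 <= (1 - eps) * ln (2 * q) by rewrite mulr_ge0 ?ln_ge0// ltW.
  have : ln eps < 0 by rewrite ln_lt0// eps0.
  by rewrite ln2q; lra.
have := key (2 * q); rewrite q2 mulr_gt0//= lte_fin ltr_pMl ?ltr1n//.
move=> /(_ isT isT); apply: le_trans; by rewrite lee_fin ln2q; lra.
Qed.
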